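(* Fix a $c\in(0,1)$. For any $0<\Gamma\le 1/16$, and any method for the safe linear bandit (SLB) problem that ensures that in every SLB instance, $\max(\mathscr{E}_T,\mathscr{S}_T)=O(T^{1-c})$, there exists an instance of the SLB problem with gap at least $\Gamma$ such that $$\liminf_{T\to\infty}\frac{\max(\mathbb{E}[\mathscr{E}_T],\mathbb{E}[\mathscr{S}_T])}{\log T}\ \ge\ \frac{c}{108}\cdot\Gamma^{-1}.$$
   Context: Safe linear bandit (SLB) setting. An instance consists of integers $d,U\ge 1$, $K\ge 0$, $m=U+K$; a known bounded polytope $\mathcal{X}=\{x\in\mathbb{R}^d: Bx\le\beta\}$ ($B$ has $K$ rows) contained in $\{\|x\|\le 1\}$; an unknown $\theta\in\mathbb{R}^d$; a matrix $A\in\mathbb{R}^{m\times d}$ with rows $a^1,\dots,a^m$ whose first $U$ rows are unknown and whose last $K$ rows are those of $B$; a known $\alpha\in\mathbb{R}^m$ whose last $K$ entries are $\beta$. Assume $\|\theta\|\le 1$, $\|a^i\|\le 1$ for all $i$, and $\mathcal{S}=\{x:Ax\le\alpha\}\ne\emptyset$. Let $x^*$ be the constrained optimum, maximising $\langle\theta,x\rangle$ over $\mathcal{S}$. Let $\mathbf{1}_U\in\mathbb{R}^m$ have its first $U$ entries $1$ and the rest $0$; for $I\subset\{1,\dots,m\}$, $M(I)$ denotes the restriction of a matrix or vector $M$ to rows in $I$. In round $t$ the learner picks $x_t\in\mathcal{X}$ based on the past history $\mathscr{H}_{t-1}$ and observes $r_t=\langle\theta,x_t\rangle+w_t^R$,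 $s_t^i=\langle a^i,x_t\rangle+w_t^{S,i}$ ($1\le i\le U$), where $w_t=(w_t^R,(w_t^{S,i})_{i\le U})$ satisfies $\mathbb{E}[w_t|\mathcal{F}_t]=0$, $\mathbb{E}[e^{\lambda^\top w_t}|\mathcal{F}_t]\le e^{\|\lambda\|^2/2}$ for all $\lambda$, with $\mathcal{F}_t=\sigma(\mathscr{H}_{t-1},x_t)$. Metrics over $T$ rounds, $(z)_+=\max(z,0)$: $\mathscr{E}_T=\sum_{t\le T}(\langle\theta,x^*-x_t\rangle)_+$, $\mathscr{S}_T=\sum_{t\le T}\big(\max_i(\langle a^i,x_t\rangle-\alpha^i)\big)_+$. Gap of an instance. A basic index set (BIS) is a set $I\subset\{1,\dots,m\}$ with $|I|=d$; $\mathcal{X}^I=\{x\in\mathcal{S}:A(I)x=\alpha(I)\}$. $I$ is optimal if $x^*\in\mathcal{X}^I$, and suboptimal otherwise. For $\zeta\ge0$ let $\mathcal{T}(\zeta;I)=\{x:Ax\le\alpha+\zeta\mathbf{1}_U,\ A(I)x\ge\alpha(I)-\zeta\mathbf{1}_U(I)\}$ and $P(\zeta;I)=\sup\{\langle\theta,x\rangle:x\in\mathcal{T}(\zeta;I)\}$ ($\sup\emptyset=-\infty$). Define $\zeta_*(I)=\inf\{\zeta\ge0:P(\zeta;I)>-\infty\}$, $\gamma(I)=\langle\theta,x^*\rangle-P(\zeta_*(I);I)$, $\mathfrak{s}(I)=\inf\{C:\forall\zeta\ge\zeta_*(I),\ P(\zeta;I)\le P(\zeta_*(I);I)+C(\zeta-\zeta_*(I))\}$,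 $\eta_*(I)=\frac{\gamma(I)+\zeta_*(I)\mathfrak{s}(I)}{1+\mathfrak{s}(I)}$; when $\zeta_*(I)=\infty$, $\max(\zeta_*(I),\eta_*(I))$ is read as $\infty$. The gap of the instance is $\min\{\max(\zeta_*(I),\eta_*(I)): I\text{ a suboptimal BIS}\}$. *)

(* Defs.v *)
From HB Require Import structures.
From mathcomp Require Import all_boot all_order all_algebra.
From mathcomp Require Import all_classical all_reals all_analysis.
From mathcomp Require Import measurable_realfun.

Set Implicit Arguments.
Unset Strict Implicit.
Unset Printing Implicit Defensive.

Import Order.TTheory GRing.Theory Num.Theory.
Import numFieldNormedType.Exports.

Local Open Scope classical_set_scope.
Local Open Scope ring_scope.

Section vectors.
Context {R : realType}.

Definition dotv {n} (u v : 'cV[R]_n) : R := (u^T *m v) 0 0.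

(* the norm that the library puts on matrices is the sup norm *)
Definition norm2 {n} (u : 'cV[R]_n) : R := Num.sqrt (dotv u u).

Definition lev {n} (u v : 'cV[R]_n) : Prop := forall i, u i 0 <= v i 0.

Definition pos_part (z : R) : R := Num.max z 0.

(* Random vectors live in n.-tuple R, which carries the product sigma-algebra
   of the Borel sets; linear algebra is done in 'cV[R]_n. *)
Definition vec {n} (x : n.-tuple R) : 'cV[R]_n := \col_i tnth x i.

End vectors.

(* What the learner knows before the first round. The actions are the points of
   X = {x | B x <= beta}; [alphaU] is the part of alpha that bounds the unknown
   rows. *)
Record known_data (R : realType) := KnownData {
  ndim : nat;
  nU : nat;
  nK : nat;
  Bmx : 'M[R]_(nK, ndim);
  beta : 'cV[R]_nK;
  alphaU : 'cV[R]_nU }.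
Arguments Bmx {R} k : rename.
Arguments beta {R} k : rename.
Arguments alphaU {R} k : rename.

Section interaction_types.
Context {R : realType} (k : known_data R).

Definition action := (ndim k).-tuple R.
(* coordinate 0 is the reward component, coordinate i.+1 is the component of the
   i-th unknown constraint *)
Definition feedback := (1 + nU k).-tuple R.
Definition history (t : nat) := t.-tuple (action * feedback)%type.

Definition domainX : set 'cV[R]_(ndim k) :=
  [set x | lev (Bmx k *m x) (beta k)].

End interaction_types.
Arguments domainX {R} k.

(* [noise t (h, x)] is the conditional law of w_t given that the history before
   the round is h and that the action x_t is x. *)
Record slb (R : realType) := Slb {
  kd :> known_data R;
  theta : 'cV[R]_(ndim kd);
  AU : 'M[R]_(nU kd, ndim kd);
  noise : forall t : nat,
    R.-pker (history kd t * action kd)%type ~> feedback kd }.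
Arguments theta {R} s : rename.
Arguments AU {R} s : rename.
Arguments noise {R} s : rename.

Section instances.
Context {R : realType} (J : slb R).
Local Notation d := (ndim J).
Local Notation m := (nU J + nK J)%N.

Definition Amx : 'M[R]_(m, d) := col_mx (AU J) (Bmx J).
Definition alpha : 'cV[R]_m := col_mx (alphaU J) (beta J).

Definition safe_set : set 'cV[R]_d := [set x | lev (Amx *m x) alpha].

Definition is_optimum (x : 'cV[R]_d) : Prop :=
  safe_set x /\ forall y, safe_set y -> dotv (theta J) y <= dotv (theta J) x.

Definition subgaussian_noise : Prop :=
  forall t (z : history J t * action J),
    (forall i, (noise J t z).-integrable setT (fun w => (tnth w i)%:E) /\
               (\int[noise J t z]_w (tnth w i)%:E = 0)%E) /\
    forall l : 'cV[R]_(1 + nU J),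
      (\int[noise J t z]_w (expR (dotv l (vec w)))%:E <=
         (expR (norm2 l ^+ 2 / 2))%:E)%E.

Definition valid_slb : Prop :=
  [/\ (1 <= d)%N, (1 <= nU J)%N,
      domainX J `<=` [set x | norm2 x <= 1] &
      [/\ norm2 (theta J) <= 1,
          forall i, norm2 (row i Amx)^T <= 1,
          safe_set !=set0 &
          subgaussian_noise]].

Section gap.
Context (xopt : 'cV[R]_d).

Definition ind_unknown : 'cV[R]_m := col_mx (const_mx 1) 0.

Definition XI (I : {set 'I_m}) : set 'cV[R]_d :=
  [set x | safe_set x /\ forall i, i \in I -> (Amx *m x) i 0 = alpha i 0].

Definition suboptimal_BIS (I : {set 'I_m}) : Prop := #|I| = d /\ ~ XI I xopt.

Definition relaxed (zeta : R) (I : {set 'I_m}) : set 'cV[R]_d :=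
  [set x | lev (Amx *m x) (alpha + zeta *: ind_unknown) /\
     forall i, i \in I ->
       (alpha - zeta *: ind_unknown) i 0 <= (Amx *m x) i 0].

Definition Pval (zeta : R) (I : {set 'I_m}) : \bar R :=
  ereal_sup [set (dotv (theta J) x)%:E | x in relaxed zeta I].

Definition zeta_star (I : {set 'I_m}) : \bar R :=
  ereal_inf [set zeta%:E | zeta in [set zeta | 0 <= zeta /\ (-oo < Pval zeta I)%E]].

(* The next three quantities matter only when [zeta_star I] is finite; then
   [Pval (fine (zeta_star I)) I] is finite, because X is compact and the infimum
   in [zeta_star] is attained. *)
Definition gamma (I : {set 'I_m}) : R :=
  dotv (theta J) xopt - fine (Pval (fine (zeta_star I)) I).

Definition slope (I : {set 'I_m}) : R :=
  inf [set C | forall zeta, fine (zeta_star I) <= zeta ->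
    (Pval zeta I <=
       Pval (fine (zeta_star I)) I + (C * (zeta - fine (zeta_star I)))%:E)%E].

Definition eta_star (I : {set 'I_m}) : R :=
  (gamma I + fine (zeta_star I) * slope I) / (1 + slope I).

(* if [zeta_star I] is +oo, so is the maximum *)
Definition gap : \bar R :=
  \big[mine/+oo%E]_(I : {set 'I_m} | `[< suboptimal_BIS I >])
    maxe (zeta_star I) (eta_star I)%:E.

End gap.

(* (r_t, s_t) when the action is x and the noise is w *)
Definition observe (x : action J) (w : feedback J) : feedback J :=
  [tuple (col_mx (theta J)^T (AU J) *m vec x + vec w) i 0 | i < 1 + nU J].

Definition extend t (z : history J t * action J * feedback J) : history J t.+1 :=
  [tuple of rcons z.1.1 (z.1.2, observe z.1.2 z.2)].

Let measurable_observe :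
  measurable_fun [set: action J * feedback J] (fun z => observe z.1 z.2).
Proof.
apply/measurable_fun_tnthP => i.
rewrite (_ : _ \o _ = (fun z : action J * feedback J =>
    \sum_j col_mx (theta J)^T (AU J) i j * tnth z.1 j + tnth z.2 i)).
  apply: measurable_funD.
    apply: measurable_sum => j; apply: measurable_funM => //.
    exact: (measurableT_comp (measurable_tnth j)).
  exact: (measurableT_comp (measurable_tnth i)).
apply/funext => z /=; rewrite tnth_mktuple !mxE.
by congr +%R; apply: eq_bigr => j _; rewrite !mxE.
Qed.

Lemma measurable_extend t : measurable_fun setT (@extend t).
Proof.
apply/measurable_fun_tnthP => i.
have [ti|ti] := ltnP i t.
  rewrite (_ : _ \o _ = (fun z : history J t * action J * feedback J =>
      tnth z.1.1 (Ordinal ti))).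
    apply: (measurableT_comp (measurable_tnth (Ordinal ti))).
    exact: measurableT_comp.
  apply/funext => z /=.
  set x0 := tnth z.1.1 _.
  by rewrite (tnth_nth x0) /= nth_rcons size_tuple ti {2}/x0 (tnth_nth x0).
rewrite (_ : _ \o _ = (fun z : history J t * action J * feedback J =>
    (z.1.2, observe z.1.2 z.2))).
  apply: measurable_fun_pair; first exact: measurableT_comp.
  apply: (measurableT_comp measurable_observe (g := fun z => (z.1.2, z.2))).
  by apply: measurable_fun_pair => //; exact: measurableT_comp.
apply/funext => z /=.
have it : i = t :> nat by apply/eqP; rewrite eqn_leq ti -ltnS ltn_ord.
by rewrite (tnth_nth (z.1.2, observe z.1.2 z.2)) /= nth_rcons size_tuple it ltnn eqxx.
Qed.

End instances.
Arguments is_optimum {R} J x.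
Arguments gap {R} J xopt.

(* the second marginal of the joint law of (x, y), where x has law mu and y has
   conditional law [k x] *)
Section bind.
Context d d' (S : measurableType d) (T : measurableType d') (R : realType).
Context (mu : probability S R) (k : R.-pker S ~> T).

Definition bind (A : set T) : \bar R := (\int[mu]_x k x A)%E.

Let bind0 : bind set0 = 0%E.
Proof. by rewrite /bind integral0_eq// => x _; rewrite measure0. Qed.

Let bind_ge0 A : (0 <= bind A)%E.
Proof. exact: integral_ge0. Qed.

Let bind_sigma_additive : semi_sigma_additive bind.
Proof.
move=> U mU tU mUU.
rewrite [X in _ --> X](_ : _ = \int[mu]_x (\sum_(n <oo) k x (U n)))%E.
  apply/cvg_closeP; split.
    by apply: is_cvg_nneseries => n _ _; exact: integral_ge0.
  rewrite closeE// integral_nneseries// => n.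
  exact: measurable_kernel.
apply: eq_integral => x _.
by apply/esym/cvg_lim => //; exact/measure_semi_sigma_additive.
Qed.

HB.instance Definition _ := isMeasure.Build _ _ _ bind
  bind0 bind_ge0 bind_sigma_additive.

Let bind_setT : bind setT = 1%E.
Proof.
rewrite /bind; under eq_integral => x _ do rewrite prob_kernel.
by rewrite integral_cst// mul1e; exact: probability_setT.
Qed.

HB.instance Definition _ := Measure_isProbability.Build _ _ _ bind bind_setT.

End bind.

(* A method chooses its actions from the data it knows and from the history, and
   may randomise. *)
Definition slb_method (R : realType) :=
  forall (k : known_data R) (t : nat), R.-pker (history k t) ~> action k.

Section interaction.
Context {R : realType} (alg : slb_method R) (J : slb R).

(* The laws of the successive histories: if h has the law after t rounds, x is
   drawn from [alg J t h] and w from [noise J t (h, x)], then the history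
   [extend (h, x, w)] has the law after t.+1 rounds. *)
Definition round t : history J t -> {measure set (history J t.+1) -> \bar R} :=
  (alg J t \; (noise J t \; kdirac (@measurable_extend R J t)))%E.

Arguments round : clear implicits.

Let measurable_round t U :
  measurable U -> measurable_fun [set: history J t] (round t ^~ U).
Proof. exact: measurable_kernel. Qed.

HB.instance Definition _ t := isKernel.Build _ _ _ _ R (round t)
  (@measurable_round t).

Let round_setT t h : round t h [set: history J t.+1] = 1%E.
Proof.
transitivity (\int[alg J t h]_x (cst 1 x))%E.
  apply: eq_integral => x _.
  transitivity (\int[noise J t (h, x)]_w (cst 1 w))%E.
    by apply: eq_integral => w _; rewrite prob_kernel.
  by rewrite integral_cst// mul1e prob_kernel.
by rewrite integral_cst// mul1e prob_kernel.
Qed.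

HB.instance Definition _ t := Kernel_isProbability.Build _ _ _ _ R (round t)
  (@round_setT t).

Fixpoint law (t : nat) : probability (history J t) R :=
  match t with
  | 0 => \d_([tuple] : history J 0)
  | t'.+1 => bind (law t') (round t')
  end.

(* coordinate i of h is round i.+1 *)
Definition efficacy_regret T (xopt : 'cV[R]_(ndim J)) (h : history J T) : R :=
  \sum_(t < T) pos_part (dotv (theta J) (xopt - vec (tnth h t).1)).

(* the maximum is taken together with 0, i.e. it is the positive part of the
   maximum over i *)
Definition safety_regret T (h : history J T) : R :=
  \sum_(t < T) \big[Num.max/0]_i ((Amx J *m vec (tnth h t).1 - alpha J) i 0).

Definition expected_regret (xopt : 'cV[R]_(ndim J)) (T : nat) : \bar R :=
  (maxe 'E_(law T)[efficacy_regret xopt] 'E_(law T)[@safety_regret T])%E.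

End interaction.
Arguments expected_regret {R} alg J xopt T.

(* The actions are in X, in every instance. The condition is not imposed on data
   that belong to no instance, because X may then be empty. *)
Definition plays_in_X (R : realType) (alg : slb_method R) : Prop :=
  forall J : slb R, valid_slb J ->
    forall t (h : history J t),
      alg J t h [set x | domainX J (vec x)] = 1%E.

Definition consistent (R : realType) (c : R) (alg : slb_method R) : Prop :=
  forall (J : slb R) (xopt : 'cV[R]_(ndim J)),
    valid_slb J -> is_optimum J xopt ->
    exists C : R, \forall T \near \oo,
      (expected_regret alg J xopt T <= (C * T%:R `^ (1 - c))%:E)%E.

(* Main.v *)
(** Proof idea. Take [d = 1], arms [x] in [[0, 1]], reward [x] observed without
    noise, and one unknown constraint [a x <= 0]. For [a = Gamma] the optimum is
    [0] and every play of [x] costs [Gamma x] in safety; for [a = 0] the optimum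
    is [1] and playing [x] costs [1 - x] in efficacy. The constraint feedback is
    a coin with values [+-1/4] and mean [a x], so the two instances differ only
    by the bias of the coin. Let [N] be the sum of the plays and [L] the
    likelihood ratio of [a = Gamma] to [a = 0]. Under [a = 0],
    [L ^ 2 exp (- 16 Gamma^2 N)] has mean at most [1], whence by AM-GM
    [P_Gamma (N <= n) <= u exp (16 Gamma^2 n) / 2 + P_0 (N <= n) / (2 u)].
    Consistency at [a = 0] gives [P_0 (N <= n) = O(T^-c)] for [n <= T / 2]; with
    [n = c ln T / (32 Gamma^2)] and [u = T^(-3c/4)] the right-hand side tends to
    [0], so the safety regret for [a = Gamma] is eventually at least
    [Gamma n / 2 = c ln T / (64 Gamma)]. *)

From HB Require Import structures.
Require Import Defs.
From mathcomp Require Import all_boot all_order all_algebra.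
From mathcomp Require Import all_classical all_reals all_analysis.
From mathcomp Require Import measurable_realfun ring lra.

Set Implicit Arguments.
Unset Strict Implicit.
Unset Printing Implicit Defensive.

Import Order.TTheory GRing.Theory Num.Theory.
Import numFieldNormedType.Exports.

Local Open Scope classical_set_scope.
Local Open Scope ring_scope.

(** * Integrals against mixtures of kernels *)

Section bind_integral.
Context d d' (S : measurableType d) (T : measurableType d') (R : realType).

(** With [mu] read as a constant kernel on [unit], [bind mu k] is a composition of kernels, and the
    integral formula for compositions applies. *)
Lemma integral_bind (mu : probability S R) (k : R.-pker S ~> T)
    (f : T -> \bar R) :
  (forall y, 0 <= f y)%E -> measurable_fun setT f ->
  (\int[bind mu k]_y f y = \int[mu]_x \int[k x]_y f y)%E.
Proof.
move=> f0 mf.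
pose l : R.-pker unit ~> S :=
  kprobability (@measurable_cst _ _ unit _ setT (mu : pprobability S R)).
rewrite -[RHS](@integral_kcomp _ _ _ _ _ _ _ l (kernel.kernel_snd k) tt)//.
Qed.

End bind_integral.

(** * Kernels supported on two points *)

Section two_point.
Context d d' (S : measurableType d) (T : measurableType d') (R : realType).
Variables (p : S -> R) (f g : S -> T).
Hypotheses (p01 : forall x, 0 <= p x <= 1) (mp : measurable_fun setT p).
Hypotheses (mf : measurable_fun setT f) (mg : measurable_fun setT g).

Let p_ge0 x : 0 <= p x. Proof. by case/andP: (p01 x). Qed.
Let q_ge0 x : 0 <= 1 - p x. Proof. by rewrite subr_ge0; case/andP: (p01 x). Qed.

Definition two_point x : {measure set T -> \bar R} :=
  measure_add (mscale (NngNum (p_ge0 x)) (\d_(f x)))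
              (mscale (NngNum (q_ge0 x)) (\d_(g x))).

Let two_pointE x U :
  two_point x U = ((p x)%:E * \d_(f x) U + (1 - p x)%:E * \d_(g x) U)%E.
Proof. by rewrite [LHS]measure_addE. Qed.

Let measurable_two_point U : measurable U ->
  measurable_fun setT (two_point ^~ U).
Proof.
move=> mU; under eq_fun do rewrite two_pointE.
apply: emeasurable_funD; apply: emeasurable_funM.
- exact/measurable_EFinP.
- exact: (measurable_kernel (kdirac mf) U mU).
- by apply/measurable_EFinP; exact: measurable_funB.
- exact: (measurable_kernel (kdirac mg) U mU).
Qed.

HB.instance Definition _ := isKernel.Build _ _ _ _ R two_point
  measurable_two_point.

Let two_point_setT x : two_point x setT = 1%E.
Proof. by rewrite two_pointE !diracT !mule1 -EFinD addrC subrK. Qed.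

HB.instance Definition _ := Kernel_isProbability.Build _ _ _ _ R two_point
  two_point_setT.

Definition two_point_pker : R.-pker S ~> T := two_point.

Lemma ge0_integral_two_point x (h : T -> \bar R) :
  (forall y, 0 <= h y)%E -> measurable_fun setT h ->
  (\int[two_point_pker x]_y h y = (p x)%:E * h (f x) + (1 - p x)%:E * h (g x))%E.
Proof.
move=> h0 mh; rewrite ge0_integral_measure_add//.
by rewrite !ge0_integral_mscale//= !integral_dirac// !diracT !mul1e.
Qed.

Lemma integrable_two_point x (h : T -> R) : measurable_fun setT h ->
  (two_point_pker x).-integrable setT (EFin \o h).
Proof.
move=> mh; apply/integrableP; split; first exact/measurable_EFinP.
rewrite ge0_integral_two_point//=; first by rewrite -!EFinM -EFinD ltry.
by apply/measurable_EFinP; exact: measurableT_comp.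
Qed.

Lemma integral_two_point x (h : T -> R) : measurable_fun setT h ->
  (\int[two_point_pker x]_y (h y)%:E =
   (p x * h (f x) + (1 - p x) * h (g x))%:E)%E.
Proof.
move=> /measurable_EFinP mh; rewrite integralE.
rewrite !ge0_integral_two_point//; last 2 first.
- exact: measurable_funeneg.
- exact: measurable_funepos.
have maxB (r : R) : Num.max r 0 - Num.max (- r) 0 = r.
  have [r0|/ltW r0] := leP 0 r.
    by rewrite max_r ?oppr_le0// subr0.
  by rewrite max_l ?oppr_ge0// sub0r opprK.
rewrite !funeposE !funenegE -!EFinN -!EFin_max -!EFinM -!EFinD.
congr EFin; rewrite -[in RHS](maxB (h (f x))) -[in RHS](maxB (h (g x))).
ring.
Qed.

End two_point.

(** * Histories, multiplicative weights and one-round recursions *)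

Section trajectories.
Context {R : realType}.

(** Unlike [extend], this appends the observed feedback rather than the noise, so it is common to
    all instances with the same known data. *)
Definition hcons (k : known_data R) t (h : history k t)
  (z : action k * feedback k) : history k t.+1 := [tuple of rcons h z].

Lemma tnth_hcons (k : known_data R) t (h : history k t) z (i : 'I_t) :
  tnth (hcons h z) (widen_ord (leqnSn t) i) = tnth h i.
Proof. by rewrite !(tnth_nth z) /= nth_rcons size_tuple ltn_ord. Qed.

Lemma tnth_hcons_max (k : known_data R) t (h : history k t) z :
  tnth (hcons h z) ord_max = z.
Proof. by rewrite (tnth_nth z) /= nth_rcons size_tuple ltnn eqxx. Qed.

Lemma measurable_observe (J : slb R) :
  measurable_fun [set: action J * feedback J] (fun z => observe z.1 z.2).
Proof.
(* [observe] is read off the last entry of the history that [extend] builds from the empty one, so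
   [measurable_extend] yields its measurability. *)
pose e (z : action J * feedback J) := extend ([tuple] : history J 0, z.1, z.2).
rewrite (_ : (fun z => _) = (fun z => (tnth (e z) ord_max).2)).
  apply: measurableT_comp => //.
  apply: (measurableT_comp (measurable_tnth ord_max)).
  apply: (measurableT_comp (@measurable_extend R J 0)).
  by apply: measurable_fun_pair => //; apply: measurable_fun_pair.
by apply/funext => z.
Qed.

Lemma measurable_hcons (k : known_data R) t :
  measurable_fun setT
    (fun z : history k t * (action k * feedback k) => hcons z.1 z.2).
Proof.
apply/measurable_fun_tnthP => i.
have [j ->|->] := unliftP ord_max i; last first.
  by rewrite (_ : _ \o _ = snd)//; apply/funext => z /=; rewrite tnth_hcons_max.
have -> : lift ord_max j = widen_ord (leqnSn t) j.
  by apply: val_inj; rewrite /= /bump leqNgt ltn_ord.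
rewrite (_ : _ \o _ = (fun z => tnth z.1 j)).
  exact: (measurableT_comp (measurable_tnth j)).
by apply/funext => z /=; rewrite tnth_hcons.
Qed.

(** Likelihood ratios of histories and their discounted squares have this shape. *)
Definition weight (k : known_data R) (phi : action k -> feedback k -> R) T
  (h : history k T) : R := \prod_(t < T) phi (tnth h t).1 (tnth h t).2.

Lemma weight_hcons (k : known_data R) (phi : action k -> feedback k -> R) T
  (h : history k T) z : weight phi (hcons h z) = weight phi h * phi z.1 z.2.
Proof.
rewrite /weight big_ord_recr /= tnth_hcons_max; congr (_ * _).
by apply: eq_bigr => i _; rewrite tnth_hcons.
Qed.

Section weight_props.
Variables (k : known_data R) (phi : action k -> feedback k -> R).
Hypothesis phi0 : forall x y, 0 <= phi x y.
Hypothesis mphi : measurable_fun setT (fun z => phi z.1 z.2).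

Lemma weight_ge0 T (h : history k T) : 0 <= weight phi h.
Proof. by apply: prodr_ge0 => i _. Qed.

Lemma measurable_weight T : measurable_fun setT (@weight k phi T).
Proof.
apply: measurable_prod => i _.
exact: (measurableT_comp mphi (measurable_tnth i)).
Qed.

End weight_props.

Section one_instance.
Variables (alg : slb_method R) (J : slb R).

(** The conditional expectation of [f] after one more round, given that the first [T] rounds
    produced [h]. *)
Definition step T (f : history J T.+1 -> \bar R) (h : history J T) : \bar R :=
  (\int[alg J T h]_x \int[noise J T (h, x)]_w f (hcons h (x, observe x w)))%E.

Section step_props.
Variables (T : nat) (f : history J T.+1 -> \bar R).
Hypotheses (f0 : forall h, (0 <= f h)%E) (mf : measurable_fun setT f).

Let inner z : (\int[noise J T z]_w f (hcons z.1 (z.2, observe z.2 w)) =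
  \int[(noise J T \; kdirac (@measurable_extend R J T))%E z]_h f h)%E.
Proof.
rewrite [RHS]integral_kcomp//; apply: eq_integral => w _.
by rewrite integral_dirac// diracT mul1e.
Qed.

Let integral_round h : (\int[round alg h]_h' f h' = step f h)%E.
Proof.
rewrite [LHS]integral_kcomp//; apply: eq_integral => x _.
by rewrite -inner.
Qed.

Lemma step_ge0 h : (0 <= step f h)%E.
Proof. by apply: integral_ge0 => x _; exact: integral_ge0. Qed.

Lemma measurable_step : measurable_fun setT (step f).
Proof.
rewrite (_ : step f = fun h => \int[round alg h]_h' f h')%E; last first.
  by apply/funext => h; rewrite integral_round.
apply: measurable_fun_integral_kernel => // U mU.
exact: (measurable_kernel [the kernel _ _ _ of (@round R alg J T)]).
Qed.

Lemma measurable_step_inner h : measurable_fun setT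
  (fun x => \int[noise J T (h, x)]_w f (hcons h (x, observe x w)))%E.
Proof.
under eq_fun do rewrite (inner (h, _)).
apply: (measurableT_comp (measurable_fun_integral_kernel _ f0 mf)
  (g := fun x => (h, x))) => //.
  move=> U mU; exact: (measurable_kernel
    [the kernel _ _ _ of (noise J T \; kdirac (@measurable_extend R J T))%E]).
exact: measurable_fun_pair.
Qed.

Lemma integral_lawS :
  (\int[law alg J T.+1]_h f h = \int[law alg J T]_h step f h)%E.
Proof.
by rewrite integral_bind//; apply: eq_integral => h _; exact: integral_round.
Qed.

Lemma stepZ h (r : R) : 0 <= r ->
  (\int[alg J T h]_x \int[noise J T (h, x)]_w
     (r%:E * f (hcons h (x, observe x w))) = r%:E * step f h)%E.
Proof.
move=> r0; rewrite /step -ge0_integralZl//.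
- apply: eq_integral => x _; rewrite ge0_integralZl//.
  apply: (measurableT_comp mf).
  apply: (measurableT_comp (@measurable_hcons J T)
    (g := fun w => (h, (x, observe x w)))).
  apply: measurable_fun_pair => //; apply: measurable_fun_pair => //.
  apply: (measurableT_comp (@measurable_observe J) (g := fun w => (x, w))).
  exact: measurable_fun_pair.
- exact: measurable_step_inner.
- by move=> x _; exact: integral_ge0.
Qed.

End step_props.

(** The weight of the past is constant once [h] is fixed, so it factors out of [step] and only the
    factor of the last round stays inside. *)
Lemma integral_weightS (phi : action J -> feedback J -> R) T
    (f : history J T.+1 -> \bar R) :
  (forall x y, 0 <= phi x y) -> measurable_fun setT (fun z => phi z.1 z.2) ->
  (forall h, 0 <= f h)%E -> measurable_fun setT f ->
  (\int[law alg J T.+1]_h (f h * (weight phi h)%:E) =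
   \int[law alg J T]_h (step (fun h =>
      f h * (phi (tnth h ord_max).1 (tnth h ord_max).2)%:E) h *
      (weight phi h)%:E))%E.
Proof.
move=> phi0 mphi f0 mf.
have mp : measurable_fun setT (fun h : history J T.+1 =>
    phi (tnth h ord_max).1 (tnth h ord_max).2).
  exact: (measurableT_comp mphi (measurable_tnth (@ord_max T))).
rewrite integral_lawS; last 2 first.
- by move=> h; rewrite mule_ge0// lee_fin weight_ge0.
- apply: emeasurable_funM => //; apply/measurable_EFinP.
  exact: (measurable_weight mphi).
apply: eq_integral => h _; rewrite muleC -stepZ; last 3 first.
- by move=> h'; rewrite mule_ge0// lee_fin.
- by apply: emeasurable_funM => //; exact/measurable_EFinP.
- exact: weight_ge0.
apply: eq_integral => x _; apply: eq_integral => w _.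
by rewrite weight_hcons tnth_hcons_max EFinM muleCA.
Qed.

Section total_mass.
Variable phi : action J -> feedback J -> R.
Hypothesis phi0 : forall x y, 0 <= phi x y.
Hypothesis mphi : measurable_fun setT (fun z => phi z.1 z.2).

Let last_phi T (h : history J T.+1) : \bar R :=
  (phi (tnth h ord_max).1 (tnth h ord_max).2)%:E.

Let last_phi0 T h : (0 <= @last_phi T h)%E. Proof. by rewrite lee_fin. Qed.

Let mlast_phi T : measurable_fun setT (@last_phi T).
Proof.
apply/measurable_EFinP.
exact: (measurableT_comp mphi (measurable_tnth (@ord_max T))).
Qed.

Let integral_weight0 : (\int[law alg J 0]_h (weight phi h)%:E = 1)%E.
Proof.
transitivity (\int[law alg J 0]_h cst 1%E h)%E.
  by apply: eq_integral => h _; rewrite /weight big_ord0.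
by rewrite (integral_cst _ measurableT) mul1e; exact: probability_setT.
Qed.

Let integral_weight_rec T :
  (\int[law alg J T.+1]_h (weight phi h)%:E =
   \int[law alg J T]_h (step (@last_phi T) h * (weight phi h)%:E))%E.
Proof.
have E : (\int[law alg J T.+1]_h (weight phi h)%:E =
    \int[law alg J T.+1]_h (1 * (weight phi h)%:E))%E.
  by apply: eq_integral => h _; rewrite mul1e.
apply: (etrans E).
have c0 (h : history J T.+1) : (0 <= (cst 1 h : \bar R))%E by exact: lee01.
have mc : measurable_fun setT (cst 1%E : history J T.+1 -> \bar R).
  exact: measurable_cst.
apply: (etrans (integral_weightS phi0 mphi c0 mc)).
apply: eq_integral => h _; congr (_ * _)%E.
apply: eq_integral => x _; apply: eq_integral => w _.
by rewrite mul1e.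
Qed.

Let step_last T h : (step (@last_phi T) h =
  \int[alg J T h]_x \int[noise J T (h, x)]_w (phi x (observe x w))%:E)%E.
Proof.
apply: eq_integral => x _; apply: eq_integral => w _.
by rewrite /last_phi tnth_hcons_max.
Qed.

(** The weights form a nonnegative supermartingale that starts at [1]. *)
Lemma integral_weight_le1 :
  (forall t (h : history J t) x,
     \int[noise J t (h, x)]_w (phi x (observe x w))%:E <= 1)%E ->
  forall T, (\int[law alg J T]_h (weight phi h)%:E <= 1)%E.
Proof.
move=> phi1; elim=> [|T IH]; first by rewrite integral_weight0.
rewrite integral_weight_rec (le_trans _ IH)//; apply: ge0_le_integral => //.
- by move=> h _; rewrite mule_ge0// ?lee_fin ?weight_ge0//; exact: step_ge0.
- apply: emeasurable_funM; first exact: measurable_step.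
  by apply/measurable_EFinP; exact: (measurable_weight mphi).
- by apply/measurable_EFinP; exact: (measurable_weight mphi).
move=> h _; rewrite -[leRHS]mul1e lee_wpmul2r ?lee_fin ?weight_ge0//.
rewrite step_last (@le_trans _ _ (\int[alg J T h]_x cst 1%E x)%E)//.
  apply: ge0_le_integral => //.
  - by move=> x _; apply: integral_ge0 => w _; rewrite lee_fin.
  - have := measurable_step_inner (@last_phi0 T) (@mlast_phi T) h.
    apply: eq_measurable_fun => x _; apply: eq_integral => w _.
    by rewrite /last_phi tnth_hcons_max.
by rewrite integral_cst// mul1e prob_kernel.
Qed.

(** Here the one-round mean is taken over the action too, so that [phi] may vanish at actions that
    the method plays with probability zero. *)
Lemma integral_weight_eq1 :
  (forall t (h : history J t),
     \int[alg J t h]_x \int[noise J t (h, x)]_w (phi x (observe x w))%:E = 1)%E ->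
  forall T, (\int[law alg J T]_h (weight phi h)%:E = 1)%E.
Proof.
move=> phi1; elim=> [|T IH]; first by rewrite integral_weight0.
rewrite integral_weight_rec -[RHS]IH; apply: eq_integral => h _.
by rewrite step_last phi1 mul1e.
Qed.

End total_mass.
End one_instance.

(** * Change of measure between two instances with the same known data *)

Section change_of_measure.
Variables (alg : slb_method R) (k : known_data R).
Variables (th1 th2 : 'cV[R]_(ndim k)) (A1 A2 : 'M[R]_(nU k, ndim k)).
Variables n1 n2 : forall t : nat,
  R.-pker (history k t * action k)%type ~> feedback k.
Let J1 := Slb th1 A1 n1.
Let J2 := Slb th2 A2 n2.
Variables phi1 phi2 : action k -> feedback k -> R.
Hypotheses (phi1_ge0 : forall x y, 0 <= phi1 x y)
  (phi2_ge0 : forall x y, 0 <= phi2 x y).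
Hypotheses (mphi1 : measurable_fun setT (fun z => phi1 z.1 z.2))
  (mphi2 : measurable_fun setT (fun z => phi2 z.1 z.2)).
Hypothesis phi12 : forall t (h : history k t) x (f : feedback k -> \bar R),
  (forall y, 0 <= f y)%E -> measurable_fun setT f ->
  (\int[n1 t (h, x)]_w (f (@observe R J1 x w) * (phi1 x (@observe R J1 x w))%:E) =
   \int[n2 t (h, x)]_w (f (@observe R J2 x w) * (phi2 x (@observe R J2 x w))%:E))%E.

(** Induction on [T] with [f] general: the method reacts to a history in the same way in both
    instances, and [phi12] matches the feedback of one round. *)
Lemma change_of_measure T (f : history k T -> \bar R) :
  (forall h, 0 <= f h)%E -> measurable_fun setT f ->
  (\int[law alg J1 T]_h (f h * (weight phi1 h)%:E) =
   \int[law alg J2 T]_h (f h * (weight phi2 h)%:E))%E.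
Proof.
elim: T f => [|T IH] f f0 mf.
  by apply: eq_integral => h _; rewrite /weight !big_ord0.
have mp : measurable_fun setT (fun h : history k T.+1 =>
    phi1 (tnth h ord_max).1 (tnth h ord_max).2).
  exact: (measurableT_comp mphi1 (measurable_tnth (@ord_max T))).
apply: (etrans (@integral_weightS alg J1 phi1 T f phi1_ge0 mphi1 f0 mf)).
apply: (etrans _ (esym (@integral_weightS alg J2 phi2 T f phi2_ge0 mphi2 f0 mf))).
set g1 := fun h : history k T.+1 => _; set g2 := fun h : history k T.+1 => _.
have g1_ge0 h : (0 <= g1 h)%E by rewrite mule_ge0// lee_fin.
have mg1 : measurable_fun setT g1.
  by apply: emeasurable_funM => //; exact/measurable_EFinP.
(* The induction hypothesis is applied to the step in [J1]; [phi12] then turns it into the step in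
   [J2], history by history. *)
apply: (etrans (IH (@step alg J1 T g1) _ _)).
- exact: (@step_ge0 alg J1 T g1 g1_ge0).
- exact: (@measurable_step alg J1 T g1 g1_ge0 mg1).
apply: eq_integral => h _; congr (_ * _)%E; apply: eq_integral => x _.
rewrite /g1 /g2; under eq_integral do rewrite tnth_hcons_max.
under [RHS]eq_integral do rewrite tnth_hcons_max.
apply: (phi12 h x (f := fun y => f (hcons h (x, y)))) => //.
apply: (measurableT_comp mf).
apply: (measurableT_comp (@measurable_hcons k T) (g := fun y => (h, (x, y)))).
by apply: measurable_fun_pair => //; exact: measurable_fun_pair.
Qed.

End change_of_measure.
End trajectories.

(** * An exponential inequality, clipping, and vectors of dimension one and two *)

Section real_lemmas.
Context {R : realType}.

(* For centered [w] with [|w| <= 1/2] this yields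
   [E exp (l w) <= E exp (2 l^2 w^2) <= exp (l^2 / 2)]. *)
Lemma expR_le_add_expR_sqr (z : R) : expR z <= z + expR (2 * z ^+ 2).
Proof.
have [z1|/ltW z1] := leP z 1; last first.
  rewrite (@le_trans _ _ (expR (2 * z ^+ 2)))//; last by rewrite lerDr; lra.
  by rewrite ler_expR; nra.
apply: (@le_trans _ _ (z + (1 + 2 * z ^+ 2))); last first.
  by rewrite lerD2l; exact: expR_ge1Dx.
have h : 0 < 1 - z / 2 by lra.
(* This is the square of [1 - z / 2 <= expR (- (z / 2))], whose left side is positive. *)
have e1 : expR z * (1 - z / 2) ^+ 2 <= 1.
  rewrite (_ : expR z = expR (z / 2) ^+ 2); last first.
    by rewrite -expRM_natl; congr expR; lra.
  rewrite -exprMn exprn_ile1 ?mulr_ge0 ?expR_ge0 ?(ltW h)//.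
  have := expR_ge1Dx (- (z / 2)); rewrite expRN => e.
  by rewrite mulrC -ler_pdivlMr ?expR_gt0// div1r.
rewrite -(ler_pM2r (exprn_gt0 2 h)) (le_trans e1)//.
(* Half of this product equals [(1 + z + 2 z^2) (1 - z / 2)^2 - 1]. *)
have : 0 <= z ^+ 2 * ((1 - z) * (5 / 2 - z)) by rewrite mulr_ge0 ?sqr_ge0// mulr_ge0; lra.
by nra.
Qed.

Definition clip01 (x : R) : R := Num.max 0 (Num.min x 1).

Lemma clip01_bounds x : 0 <= clip01 x <= 1.
Proof.
by rewrite /clip01 le_max lexx/= ge_max ler01/= ge_min lexx orbT.
Qed.

Lemma clip01_id x : 0 <= x <= 1 -> clip01 x = x.
Proof. by case/andP=> x0 x1; rewrite /clip01 (min_idPl x1) (max_idPr x0). Qed.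

Lemma measurable_clip01 : measurable_fun setT clip01.
Proof. by apply: measurable_maxr => //; exact: measurable_minr. Qed.

Lemma dotv1 (u v : 'cV[R]_1) : dotv u v = u 0 0 * v 0 0.
Proof. by rewrite /dotv mxE big_ord1 mxE. Qed.

Lemma dotv2 (u v : 'cV[R]_(1 + 1)) :
  dotv u v = u 0 0 * v 0 0 + u ord_max 0 * v ord_max 0.
Proof.
rewrite /dotv mxE big_ord_recl big_ord1 !mxE.
by congr (_ + u _ 0 * v _ 0); exact: val_inj.
Qed.

Lemma norm2_sqr n (u : 'cV[R]_n) : norm2 u ^+ 2 = dotv u u.
Proof.
rewrite /norm2 sqr_sqrtr// /dotv mxE; apply: sumr_ge0 => i _.
by rewrite mxE -expr2 sqr_ge0.
Qed.

Lemma norm2_le1 (u : 'cV[R]_1) : `|u 0 0| <= 1 -> norm2 u <= 1.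
Proof. by move=> u1; rewrite /norm2 dotv1 -expr2 sqrtr_sqr. Qed.

End real_lemmas.

(** * The coin instances *)

Section coin_instance.
Context {R : realType}.

(** The known rows are [x <= 1] and [- x <= 0], so the arm set is [[0, 1]]; the unknown row is
    bounded by [0]. *)
Definition unit_data : known_data R :=
  @KnownData R 1 1 (1 + 1) (col_mx (const_mx 1) (const_mx (- 1)) : 'M[R]_(1 + 1, 1))
    (col_mx (const_mx 1) 0 : 'cV[R]_(1 + 1)) 0.

Definition pt (x : action unit_data) : R := tnth x ord0.

Lemma measurable_pt : measurable_fun setT pt.
Proof. exact: measurable_tnth. Qed.

Lemma domainX_unit (x : 'cV[R]_1) :
  domainX unit_data x <-> 0 <= x 0 0 <= 1.
Proof.
rewrite /domainX /= /lev; split.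
  move=> h; have := h (lshift 1 (0 : 'I_1)); have := h (rshift 1 (0 : 'I_1)).
  rewrite ![(_ *m _) _ _]mxE !big_ord1 !(col_mxEu, col_mxEd) !mxE => h1 h2.
  by apply/andP; split; lra.
move=> /andP[x0 x1] i; case: (@split_ordP 1 1 i) => j ->;
rewrite [(_ *m _) _ _]mxE big_ord1 /= !(col_mxEu, col_mxEd) !mxE; lra.
Qed.

Variable a : R.
Hypothesis a_bounds : 0 <= a <= 1 / 16.

(** A coin that shows [1/4] with this probability and [- (1/4)] otherwise has mean [a x], for [x]
    the clipped action. *)
Definition heads t (z : history unit_data t * action unit_data) : R :=
  (1 + 4 * a * clip01 (pt z.2)) / 2.

(* With the coin showing [s], the observation [a x + w] is [s] for [x] in the
   arm set; clipping keeps the noise centered and bounded for all other [x]. *)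
Definition noise_value s t (z : history unit_data t * action unit_data) :
    feedback unit_data :=
  [tuple if i == ord0 then 0 else s - a * clip01 (pt z.2) | i < 1 + 1].

Let heads01 t z : 0 <= @heads t z <= 1.
Proof.
rewrite /heads; have /andP[] := clip01_bounds (pt z.2).
by move: a_bounds => /andP[]; nra.
Qed.

Let mclip t : measurable_fun setT
  (fun z : history unit_data t * action unit_data => clip01 (pt z.2)).
Proof.
apply: (measurableT_comp measurable_clip01).
exact: (measurableT_comp measurable_pt).
Qed.

Let measurable_heads t : measurable_fun setT (@heads t).
Proof.
apply: measurable_funM => //; apply: measurable_funD => //.
by apply: measurable_funM => //; exact: mclip.
Qed.

Let measurable_noise_value s t : measurable_fun setT (@noise_value s t).
Proof.
apply/measurable_fun_tnthP => i.
rewrite (_ : _ \o _ = fun z => if i == ord0 then 0 else s - a * clip01 (pt z.2)).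
  case: (i == ord0) => //.
  by apply: measurable_funB => //; apply: measurable_funM => //; exact: mclip.
by apply/funext => z /=; rewrite tnth_mktuple.
Qed.

Definition coin_noise t : R.-pker (history unit_data t * action unit_data)%type
    ~> feedback unit_data :=
  two_point_pker (@heads01 t) (@measurable_heads t)
    (@measurable_noise_value (1 / 4) t) (@measurable_noise_value (- (1 / 4)) t).

Definition coin_slb : slb R :=
  @Slb R unit_data (const_mx 1) (const_mx a) coin_noise.

End coin_instance.
Arguments unit_data : clear implicits.

(** * Validity and safety regret of the coin instances *)

Section coin_facts.
Context {R : realType}.
Local Notation D := (unit_data R).
Variable a : R.
Hypothesis a_bounds : 0 <= a <= 1 / 16.
Local Notation J := (coin_slb a_bounds).

(** The reward noise is zero, and the constraint noise is centered and at most [5/16] in absolute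
    value, so [expR_le_add_expR_sqr] applies to both of its values. *)
Lemma coin_subgaussian : subgaussian_noise J.
Proof.
move=> t z; have /andP[k0 k1] := clip01_bounds (pt z.2).
have mw (i : 'I_(1 + 1)) : measurable_fun setT (fun w : feedback J => tnth w i).
  exact: measurable_tnth.
have /andP[a0 a1] := a_bounds.
split=> [i|l].
  split; first exact: (integrable_two_point _ _ _ _ _ (mw i)).
  rewrite (integral_two_point _ _ _ _ _ (mw i)) !tnth_mktuple /heads.
  by case: ifP => _; congr EFin; field.
have me : measurable_fun setT (fun w : feedback J => expR (dotv l (vec w))).
  apply: measurableT_comp => //.
  under eq_fun do rewrite dotv2 !mxE.
  by apply: measurable_funD; apply: measurable_funM => //; exact: mw.
rewrite (integral_two_point _ _ _ _ _ me) lee_fin norm2_sqr !dotv2 !mxE.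
rewrite !tnth_mktuple /= !mulr0 !add0r.
set l1 := l _ 0; set m := a * clip01 _.
have m0 : 0 <= m by rewrite mulr_ge0.
have m1 : m <= 1 / 16 by rewrite /m; nra.
have hp : heads a z = (1 + 4 * m) / 2 by rewrite /heads /m mulrA.
(* The linear terms [l1 * (s - m)] cancel when the two values are averaged with the probabilities of
   the coin. *)
have bnd s : (s == 1 / 4) || (s == - (1 / 4)) ->
    expR (l1 * (s - m)) <= l1 * (s - m) + expR ((l 0 0 * l 0 0 + l1 * l1) / 2).
  move=> s4; apply: (le_trans (expR_le_add_expR_sqr _)).
  rewrite lerD2l ler_expR exprMn.
  have sm : (s - m) ^+ 2 <= 1 / 4.
    by case/orP: s4 => /eqP ->; nra.
  have := sqr_ge0 l1; have := sqr_ge0 (l 0 0); rewrite -!expr2.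
  by nra.
have b1 := bnd (1 / 4); rewrite eqxx in b1; have {b1} := b1 isT.
have b2 := bnd (- (1 / 4)); rewrite eqxx orbT in b2; have {b2} := b2 isT.
rewrite hp; set E := expR (_ / 2).
set e1 := expR _; set e2 := expR _.
by nra.
Qed.

Lemma coin_safeP (x : 'cV[R]_1) :
  @safe_set R J x <-> 0 <= x 0 0 <= 1 /\ a * x 0 0 <= 0.
Proof.
split=> [h|[x01 ax] i].
  split; last first.
    have := h (lshift (1 + 1) (0 : 'I_1)).
    rewrite [(_ *m _) _ _]mxE big_ord1 /Amx /alpha /=.
    by rewrite !col_mxEu !mxE.
  apply/domainX_unit => j; have := h (rshift 1 j).
  by rewrite /Amx /alpha mul_col_mx !col_mxEd.
case: (@split_ordP 1 (1 + 1) i) => j ->; rewrite /Amx /alpha mul_col_mx.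
  by rewrite !col_mxEu !mxE big_ord1 !mxE ord1.
by rewrite !col_mxEd; exact: (domainX_unit x).2.
Qed.

Lemma coin_valid : valid_slb J.
Proof.
have /andP[a0 a1] := a_bounds.
split=> //.
  move=> x /domainX_unit /andP[x0 x1]; apply: norm2_le1.
  by rewrite ger0_norm.
split.
- by apply: norm2_le1; rewrite mxE normr1.
- move=> i; apply: norm2_le1; rewrite !mxE.
  case: (@split_ordP 1 (1 + 1) i) => j _; rewrite ?mxE.
    by rewrite ger0_norm; lra.
  by case: (@split_ordP 1 1 j) => j' _; rewrite mxE ?normrN normr1.
- exists 0; apply/coin_safeP; rewrite mxE; split; lra.
- exact: coin_subgaussian.
Qed.

(** The unknown row is violated by [a x], and [clip01 x <= x] for [x >= 0]; a negative play counts
    [0] on the left and at least [0] on the right. Hence no restriction to plays in the arm set. *)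
Lemma coin_safety_regret T (h : history D T) :
  a * \sum_(t < T) clip01 (pt (tnth h t).1) <= @safety_regret R J T h.
Proof.
have /andP[a0 a1] := a_bounds.
rewrite mulr_sumr; apply: ler_sum => t _.
set x := (tnth h t).1.
have [x0|x0] := leP 0 (pt x); last first.
  rewrite /clip01 max_l ?mulr0; last by rewrite ge_min (ltW x0).
  exact: bigmax_ge_id.
apply: le_trans (le_bigmax _ _ (lshift (1 + 1) (0 : 'I_1))).
rewrite [leRHS]mxE [X in _ + X]mxE [(_ *m _) _ _]mxE big_ord1 /Amx /alpha /= !col_mxEu !mxE.
by rewrite subr0 ler_wpM2l// ge_max x0/= ge_min lexx.
Qed.

Lemma measurable_safety_regret T :
  measurable_fun setT (@safety_regret R J T).
Proof.
apply: measurable_sum => t.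
pose g i (h : history D T) : R :=
  (Amx J *m vec (tnth h t).1 - alpha J) i 0.
have mg i : measurable_fun setT (g i).
  rewrite (_ : g i = fun h => Amx J i 0 * pt (tnth h t).1 - alpha J i 0).
    apply: measurable_funB => //; apply: measurable_funM => //.
    apply: (measurableT_comp measurable_pt).
    exact: (measurableT_comp measurable_fst (measurable_tnth t)).
  apply/funext => h; rewrite /g [LHS]mxE [X in _ + X]mxE [(_ *m _) _ _]mxE big_ord1.
  by rewrite [vec _ _ _]mxE.
rewrite (_ : (fun h => _) = (fun h => \big[Num.max/0]_i g i h))//.
elim: (index_enum _) => [|i s IH].
  by under eq_fun do rewrite big_nil; exact: measurable_cst.
by under eq_fun do rewrite big_cons; exact: measurable_maxr.
Qed.

End coin_facts.

(** * Likelihood ratios of the coin and the exploration bound *)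

Section likelihood.
Context {R : realType}.
Local Notation D := (unit_data R).
Variable alg : slb_method R.
Variable a : R.
Hypotheses (a_bounds : 0 <= a <= 1 / 16) (z_bounds : 0 <= (0 : R) <= 1 / 16).
Local Notation Ja := (coin_slb a_bounds).
Local Notation J0 := (coin_slb z_bounds).

Definition signal (y : feedback D) : R := tnth y (@ord_max 1).

Definition outcome (x : action D) (s : R) : feedback D :=
  [tuple if i == ord0 then pt x else s | i < 1 + 1].

(** On the arm set the mean [b x] cancels the centering of the noise, so the feedback reveals [b]
    only through the bias of the coin. *)
Lemma observe_noise_value b (Hb : 0 <= b <= 1 / 16) s t
    (h : history D t) (x : action D) : 0 <= pt x <= 1 ->
  @observe R (coin_slb Hb) x (noise_value b s (h, x)) = outcome x s.
Proof.
move=> x01; apply: eq_from_tnth => i; rewrite !tnth_mktuple.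
rewrite [LHS]mxE [(_ *m _) _ _]mxE big_ord1 [vec _ _ _]mxE [vec _ _ _]mxE.
rewrite tnth_mktuple /= (clip01_id x01).
case: (@split_ordP 1 1 i) => j ->; rewrite !(col_mxEu, col_mxEd) ord1 /=.
  by rewrite !mxE mul1r addr0.
by rewrite mxE addrC subrK.
Qed.

Definition in_unit (r : R) : R := ((0 <= r <= 1)%R : bool)%:R.

Lemma measurable_in_unit : measurable_fun setT in_unit.
Proof.
rewrite (_ : in_unit = \1_(`[0, 1]%classic)).
  exact: measurable_indic.
by apply/funext => r; rewrite indicE mem_setE in_itv.
Qed.

(* The indicator of the arm set is kept in the likelihood ratio, so that the change
   of measure holds for all actions, not only almost surely. *)
Definition inside (x : action D) (y : feedback D) : R :=
  in_unit (pt x).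

(** At the signals [1/4] and [- (1/4)] this is [1 + 4 a x] and [1 - 4 a x], the ratios of the biased
    to the fair coin. The absolute value keeps it nonnegative at all other feedback. *)
Definition likelihood (x : action D) (y : feedback D) : R :=
  in_unit (pt x) * `|1 + 16 * a * pt x * signal y|.

(** The exponent is linear in the play, so over a history the discount depends on [total_play]
    alone. *)
Definition discounted (x : action D) (y : feedback D) : R :=
  likelihood x y ^+ 2 * expR (- (16 * a ^+ 2 * clip01 (pt x))).

Lemma inside_ge0 x y : 0 <= inside x y.
Proof. exact: ler0n. Qed.

Lemma likelihood_ge0 x y : 0 <= likelihood x y.
Proof. by rewrite mulr_ge0// ler0n. Qed.

Lemma discounted_ge0 x y : 0 <= discounted x y.
Proof. by rewrite mulr_ge0 ?sqr_ge0 ?expR_ge0. Qed.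

Let mpt : measurable_fun setT
  (fun z : action D * feedback D => pt z.1).
Proof. exact: (measurableT_comp measurable_pt). Qed.

Lemma measurable_inside : measurable_fun setT (fun z => inside z.1 z.2).
Proof. exact: (measurableT_comp measurable_in_unit). Qed.

Lemma measurable_likelihood : measurable_fun setT (fun z => likelihood z.1 z.2).
Proof.
apply: measurable_funM; first exact: measurable_inside.
apply: measurableT_comp => //.
apply: measurable_funD => //; apply: measurable_funM.
  by apply: measurable_funM.
exact: (measurableT_comp (measurable_tnth (@ord_max 1))).
Qed.

Lemma measurable_discounted : measurable_fun setT (fun z => discounted z.1 z.2).
Proof.
apply: measurable_funM.
  by apply: measurable_funX; exact: measurable_likelihood.
apply: measurableT_comp => //; apply: measurableT_comp => //.
by apply: measurable_funM => //; exact: (measurableT_comp measurable_clip01).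
Qed.

Let mobs (J : slb R) (x : action J) (f : feedback J -> \bar R) :
  measurable_fun setT f -> measurable_fun setT (fun w => f (observe x w)).
Proof.
move=> mf; apply: (measurableT_comp mf).
apply: (measurableT_comp (@measurable_observe R J) (g := fun w => (x, w))).
exact: measurable_fun_pair.
Qed.

Let msnd (phi : action D -> feedback D -> R) x :
  measurable_fun setT (fun z => phi z.1 z.2) -> measurable_fun setT (phi x).
Proof.
move=> mphi; apply: (measurableT_comp mphi (g := fun y => (x, y))).
exact: measurable_fun_pair.
Qed.

Lemma likelihood_ratio t (h : history D t) (x : action D)
    (f : feedback D -> \bar R) :
  (forall y, 0 <= f y)%E -> measurable_fun setT f ->
  (\int[coin_noise a_bounds t (h, x)]_w
     (f (@observe R Ja x w) * (inside x (@observe R Ja x w))%:E) =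
   \int[coin_noise z_bounds t (h, x)]_w
     (f (@observe R J0 x w) * (likelihood x (@observe R J0 x w))%:E))%E.
Proof.
move=> f0 mf; have /andP[a0 a1] := a_bounds.
rewrite ge0_integral_two_point; last 2 first.
- by move=> w; rewrite mule_ge0// lee_fin inside_ge0.
- apply: (@mobs Ja x (fun y => f y * (inside x y)%:E)%E).
  apply: emeasurable_funM => //; apply/measurable_EFinP.
  exact: (msnd x measurable_inside).
rewrite ge0_integral_two_point; last 2 first.
- by move=> w; rewrite mule_ge0// lee_fin likelihood_ge0.
- apply: (@mobs J0 x (fun y => f y * (likelihood x y)%:E)%E).
  apply: emeasurable_funM => //; apply/measurable_EFinP.
  exact: (msnd x measurable_likelihood).
(* Off the arm set both weights vanish. On it, the probabilities [(1 + 4 a x) / 2] and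
   [(1 - 4 a x) / 2] are the fair [1/2] times the ratio. *)
have [x01|x01] := boolP (0 <= pt x <= 1); last first.
  by rewrite /likelihood /inside /in_unit (negbTE x01) !mul0r !mule0.
rewrite !observe_noise_value// /heads /likelihood /inside /in_unit x01.
rewrite clip01_id//= !mul1r /signal !tnth_mktuple /=.
have /andP[x0 x1] := x01; have ax0 : 0 <= a * pt x by rewrite mulr_ge0.
have ax1 : a * pt x <= 1 / 16 by nra.
rewrite !mule1 !ger0_norm; [|nra|nra].
rewrite !(muleCA (EFin _) (f _)) -!EFinM !(muleC (EFin _) (f _)).
by congr (_ * _ + _ * _)%E; congr EFin; field.
Qed.

(** Under the fair coin the squared ratio has mean [1 + 16 a^2 x^2], which is at most
    [expR (16 a^2 x)] because [x^2 <= x] on the arm set. *)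
Lemma discounted_le1 t (h : history D t) (x : action D) :
  (\int[coin_noise z_bounds t (h, x)]_w (discounted x (@observe R J0 x w))%:E
     <= 1)%E.
Proof.
have /andP[a0 a1] := a_bounds.
rewrite ge0_integral_two_point; last 2 first.
- by move=> w; rewrite lee_fin discounted_ge0.
- apply: (@mobs J0 x (fun y => (discounted x y)%:E)); apply/measurable_EFinP.
  exact: (msnd x measurable_discounted).
rewrite /discounted /likelihood /in_unit.
have [x01|x01] := boolP (0 <= pt x <= 1); last first.
  by rewrite !(mul0r, expr0n, mule0, adde0)/= ?lee_fin.
rewrite !observe_noise_value// /signal !tnth_mktuple /= !mul1r.
rewrite clip01_id// /heads clip01_id// !real_normK ?num_real//.
rewrite -!EFinM -EFinD lee_fin; have /andP[x0 x1] := x01.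
set e := expR _.
rewrite [leLHS](_ : _ = (1 + 16 * a ^+ 2 * pt x ^+ 2) * e); last by field.
rewrite /e expRN ler_pdivrMr ?expR_gt0// mul1r.
apply: le_trans (expR_ge1Dx _); rewrite lerD2l ler_wpM2l ?mulr_ge0 ?sqr_ge0//.
by rewrite expr2 ler_piMl.
Qed.

Definition total_play T (h : history D T) : R :=
  \sum_(t < T) clip01 (pt (tnth h t).1).

Lemma measurable_total_play T : measurable_fun setT (@total_play T).
Proof.
apply: measurable_sum => t; apply: (measurableT_comp measurable_clip01).
apply: (measurableT_comp measurable_pt).
exact: (measurableT_comp measurable_fst (measurable_tnth t)).
Qed.

Lemma measurable_total_play_le T (n : R) :
  measurable [set h : history D T | total_play h <= n].
Proof.
rewrite (_ : mkset _ = setT `&` (@total_play T) @^-1` `]-oo, n]%classic).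
  exact: measurable_total_play.
by rewrite setTI; apply/seteqP; split => h /=; rewrite in_itv.
Qed.

Lemma measurable_total_play_gt T (n : R) :
  measurable [set h : history D T | n < total_play h].
Proof.
rewrite (_ : mkset _ = setT `&` (@total_play T) @^-1` `]n, +oo[%classic).
  exact: measurable_total_play.
by rewrite setTI; apply/seteqP; split => h /=; rewrite in_itv /= andbT.
Qed.

Lemma weight_discounted T (h : history D T) :
  weight discounted h =
  weight likelihood h ^+ 2 * expR (- (16 * a ^+ 2 * total_play h)).
Proof.
rewrite /weight big_split /= prodrXl /total_play mulr_sumr -sumrN expR_sum.
by [].
Qed.

Lemma weight_inside_le1 T (h : history D T) : weight inside h <= 1.
Proof.
by apply: prodr_ile1 => i _; rewrite inside_ge0 /inside /in_unit lern1 leq_b1.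
Qed.

Hypothesis alg_X : plays_in_X alg.

(** The method plays in [[0, 1]] almost surely, so truncating by [inside] loses no mass. *)
Lemma integral_weight_inside T :
  (\int[law alg Ja T]_h (weight inside h)%:E = 1)%E.
Proof.
apply: (@integral_weight_eq1 R alg Ja inside inside_ge0 measurable_inside) => t h.
pose A := [set x : action D | 0 <= pt x <= 1].
transitivity (\int[alg Ja t h]_x (\1_A x)%:E)%E.
  apply: eq_integral => x _.
  rewrite -[RHS]mule1 -(@prob_kernel _ _ _ _ _ (coin_noise a_bounds t) (h, x)).
  rewrite -[RHS]integral_cst//; apply: eq_integral => w _.
  rewrite /cst indicE /inside /in_unit; congr ((nat_of_bool _)%:R)%:E.
  by apply/idP/idP; rewrite inE.
rewrite integral_indic ?setIT//; last first.
  rewrite (_ : A = setT `&` @pt R @^-1` `[0, 1]%classic).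
    exact: measurable_pt.
  by rewrite setTI; apply/seteqP; split => x /=; rewrite in_itv.
rewrite -(alg_X (coin_valid a_bounds) h); congr (alg _ _ _ _).
apply/seteqP; split => x /= x01.
  by apply/domainX_unit; rewrite mxE.
by move/domainX_unit : x01; rewrite mxE.
Qed.

(** The event of little play is transported from [Ja] to [J0], where AM-GM with parameter [u] splits
    its weight into a second moment and a probability. *)
Lemma exploration_bound T (n u : R) : 0 < u ->
  (1 <= law alg Ja T [set h | n < total_play h]%R +
     ((u / 2 * expR (16 * a ^+ 2 * n))%:E +
      ((2 * u)^-1)%:E * law alg J0 T [set h | total_play h <= n]%R))%E.
Proof.
move=> u0; set P := law alg Ja T; set Q := law alg J0 T.
pose B := [set h : history D T | total_play h <= n].
have mB : measurable B := measurable_total_play_le n.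
have -> : [set h | n < total_play h] = ~` B.
  by apply/seteqP; split => h /=; rewrite /B /= ltNge => /negP.
rewrite -/B.
have m1B : measurable_fun setT (EFin \o (\1_B : history D T -> R)).
  by apply/measurable_EFinP; exact: measurable_indic.
have mw phi : measurable_fun setT (fun z => phi z.1 z.2) ->
    measurable_fun setT (fun h : history D T => (weight phi h)%:E).
  by move=> mphi; apply/measurable_EFinP; exact: (measurable_weight mphi).
have m1Bw phi : measurable_fun setT (fun z => phi z.1 z.2) ->
    measurable_fun setT (fun h : history D T =>
      ((\1_B h)%:E * (weight phi h)%:E)%E).
  by move=> mphi; apply: emeasurable_funM => //; exact: mw.
(* [weight inside] has total mass [1] and is at most [1], so its mass off [B] is at most the
   probability of the complement. *)
have E1 : (1 <= P (~` B) + \int[P]_h ((\1_B h)%:E * (weight inside h)%:E))%E.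
  have -> : P (~` B) = (\int[P]_h (\1_(~` B) h)%:E)%E.
    by rewrite integral_indic ?setIT//; exact: measurableC.
  rewrite -ge0_integralD//; last 3 first.
  - by apply/measurable_EFinP; apply: measurable_indic; exact: measurableC.
  - by move=> h _; rewrite -EFinM lee_fin mulr_ge0 ?weight_ge0//; exact: inside_ge0.
  - exact: (m1Bw _ measurable_inside).
  rewrite -[leLHS](integral_weight_inside T); apply: ge0_le_integral => //.
  - by move=> h _; rewrite lee_fin weight_ge0//; exact: inside_ge0.
  - exact: (mw _ measurable_inside).
  - apply: emeasurable_funD; last exact: (m1Bw _ measurable_inside).
    by apply/measurable_EFinP; apply: measurable_indic; exact: measurableC.
  move=> h _; rewrite -EFinM -EFinD lee_fin !indicE in_setC.
  case: (h \in B) => /=; first by rewrite mul1r add0r.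
  by rewrite mul0r addr0 weight_inside_le1.
apply: (le_trans E1); rewrite leeD2l//.
have -> : (\int[P]_h ((\1_B h)%:E * (weight inside h)%:E) =
    \int[Q]_h ((\1_B h)%:E * (weight likelihood h)%:E))%E.
  apply: (change_of_measure alg inside_ge0 likelihood_ge0 measurable_inside
    measurable_likelihood likelihood_ratio) => // h.
set K := u / 2 * _.
have K0 : 0 <= K by rewrite mulr_ge0 ?expR_ge0 ?divr_ge0 ?ltW.
have v0 : 0 <= (2 * u)^-1 by rewrite invr_ge0 mulr_ge0// ltW.
have QB : Q B = (\int[Q]_h (\1_B h)%:E)%E by rewrite integral_indic ?setIT.
apply: (@le_trans _ _ (\int[Q]_h (K%:E * (weight discounted h)%:E +
    ((2 * u)^-1)%:E * (\1_B h)%:E)))%E.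
  apply: ge0_le_integral => //.
  - by move=> h _; rewrite -EFinM lee_fin mulr_ge0 ?weight_ge0//; exact: likelihood_ge0.
  - exact: (m1Bw _ measurable_likelihood).
  - apply: emeasurable_funD; apply: measurable_funeM => //.
    exact: (mw _ measurable_discounted).
  move=> h _; rewrite -!EFinM -EFinD lee_fin indicE.
  have w0 : 0 <= weight discounted h by apply: weight_ge0; exact: discounted_ge0.
  have [hB|hB] := boolP (h \in B); last first.
    by rewrite mul0r mulr0 addr0 mulr_ge0.
  rewrite mul1r mulr1; move: hB; rewrite inE /B /= => hB.
  set l := weight likelihood h.
  apply: (@le_trans _ _ (u / 2 * l ^+ 2 + (2 * u)^-1)).
    (* AM-GM as a completed square. *)
    have -> : u / 2 * l ^+ 2 + (2 * u)^-1 = l + (u * l - 1) ^+ 2 / (2 * u).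
      by field; rewrite gt_eqF.
    by rewrite lerDl divr_ge0 ?sqr_ge0// mulr_ge0// ltW.
  rewrite lerD2r weight_discounted -/l /K.
  (* On [B] the total play is at most [n], so the exponential in [K] outweighs the discount. *)
  rewrite [leRHS]mulrACA ler_peMr//.
    by rewrite mulr_ge0 ?sqr_ge0// divr_ge0 ?ltW.
  rewrite -expRD -[leLHS]expR0 ler_expR -mulrBr.
  by rewrite mulr_ge0 ?subr_ge0// mulr_ge0 ?sqr_ge0.
rewrite ge0_integralD//; last 4 first.
- by move=> h _; rewrite -EFinM lee_fin mulr_ge0 ?weight_ge0//; exact: discounted_ge0.
- by apply: measurable_funeM; exact: (mw _ measurable_discounted).
- by move=> h _; rewrite -EFinM lee_fin mulr_ge0.
- exact: measurable_funeM.
rewrite !ge0_integralZl//; last 2 first.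
- exact: (mw _ measurable_discounted).
- by move=> h _; rewrite lee_fin weight_ge0//; exact: discounted_ge0.
rewrite QB leeD2r// -[leRHS]mule1 lee_wpmul2l ?lee_fin//.
apply: (@integral_weight_le1 R alg J0 discounted discounted_ge0
  measurable_discounted) => t h x; exact: discounted_le1.
Qed.

End likelihood.

(** * Optima, gap and regret bounds of the coin instances *)

Section coin_regret.
Context {R : realType}.
Local Notation D := (unit_data R).
Variable alg : slb_method R.
Variables (a : R) (a_bounds : 0 <= a <= 1 / 16).
Local Notation Ja := (coin_slb a_bounds).

Lemma coin_optimum0 : 0 < a -> is_optimum Ja (0 : 'cV[R]_1).
Proof.
move=> a0; split; first by apply/coin_safeP; rewrite mxE; split; lra.
move=> y /coin_safeP[/andP[y0 _] ay0]; rewrite !dotv1 !mxE.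
by rewrite !mul1r -(pmulr_rle0 _ a0).
Qed.

Lemma coin_optimum1 : a = 0 -> is_optimum Ja (const_mx 1 : 'cV[R]_1).
Proof.
move=> a0; split; first by apply/coin_safeP; rewrite mxE a0; split; lra.
by move=> y /coin_safeP[/andP[_ y1] _]; rewrite !dotv1 !mxE !mul1r.
Qed.

(** The only suboptimal BIS is the row [x <= 1]. Meeting it forces the play [1], which violates the
    unknown row by [a], so [zeta_star] is already at least [a]. *)
Lemma coin_gap : (a%:E <= gap Ja (0 : 'cV[R]_1))%E.
Proof.
have /andP[a0 a1] := a_bounds.
apply: (big_ind (fun z => (a%:E <= z)%E)) => [|u v|I /asboolP[cI nI]].
- exact: leey.
- by rewrite le_min => -> ->.
have /cards1P[i Ii] : #|I| == 1 by rewrite cI.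
rewrite le_max; apply/orP; left.
have safe0 : @safe_set R Ja (0 : 'cV[R]_1).
  by apply/coin_safeP; rewrite mxE; split; lra.
(* The other two rows, [a x <= 0] and [- x <= 0], are tight at the optimum [0]. *)
have ai : i = rshift 1 (lshift 1 (0 : 'I_1)) :> 'I_(1 + (1 + 1)).
  apply: contra_notP nI => ni; split=> // j; rewrite Ii inE => /eqP ->.
  rewrite mulmx0 mxE /alpha; move: ni.
  case: (@split_ordP 1 (1 + 1) i) => k ->; first by rewrite col_mxEu mxE.
  case: (@split_ordP 1 1 k) => l ->; rewrite ?ord1//.
  by rewrite col_mxEd /= col_mxEd mxE.
apply: le_ereal_inf_tmp => _ [zeta [zeta0 Pz] <-]; rewrite lee_fin.
have [x [hx hI]] : @relaxed R Ja zeta I !=set0.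
  apply/set0P/negP => /eqP r0; move: Pz.
  by rewrite /Pval r0 image_set0 ereal_sup0 ltxx.
have ax : a * x 0 0 <= zeta.
  have := hx (lshift (1 + 1) (0 : 'I_1)).
  rewrite [(_ *m _) _ _]mxE big_ord1 [X in _ <= X]mxE [X in _ <= _ + X]mxE.
  by rewrite /Amx /alpha /ind_unknown !col_mxEu !mxE /= mulr1 add0r.
(* The row [x <= 1] is known, so [ind_unknown] vanishes there and [zeta] does not loosen it. *)
have x1 : 1 <= x 0 0.
  have := hI i; rewrite Ii inE eqxx ai => /(_ isT).
  rewrite [(_ *m _) _ _]mxE big_ord1 [X in X <= _]mxE [X in _ + X <= _]mxE.
  rewrite [X in _ - X <= _]mxE !col_mxEd /= !col_mxEu !mxE.
  by rewrite mulr0 subr0 mul1r.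
nra.
Qed.

Lemma total_play_ge0 T (h : history D T) : 0 <= total_play h.
Proof. by apply: sumr_ge0 => t _; case/andP: (clip01_bounds (pt (tnth h t).1)). Qed.

(** Markov's inequality for the safety regret, which is at least [a] times the total play. *)
Lemma safety_lower (x : 'cV[R]_1) T (n : R) : 0 <= n ->
  ((a * n)%:E * law alg Ja T [set h : history D T | n < total_play h]%R <=
   expected_regret alg Ja x T)%E.
Proof.
move=> n0; have /andP[a0 a1] := a_bounds.
set B := [set h : history D T | _]; have mB : measurable B := measurable_total_play_gt n.
rewrite /expected_regret le_max; apply/orP; right; rewrite unlock.
rewrite -[B]setIT -integral_indic// -ge0_integralZl//; last 2 first.
- by apply/measurable_EFinP; exact: measurable_indic.
- by rewrite lee_fin mulr_ge0.
apply: ge0_le_integral => //.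
- by move=> h _; rewrite -EFinM lee_fin !mulr_ge0.
- by apply: measurable_funeM; apply/measurable_EFinP; exact: measurable_indic.
- by apply/measurable_EFinP; exact: measurable_safety_regret.
move=> h _; rewrite -EFinM lee_fin indicE.
apply: le_trans (coin_safety_regret a_bounds h).
have [hB|hB] := boolP (h \in B); last first.
  by rewrite mulr0 mulr_ge0// total_play_ge0.
by rewrite mulr1 ler_wpM2l//; move: hB; rewrite inE => /ltW.
Qed.

(** Against the arm [1] the efficacy regret is at least [T - total_play h], and Markov's inequality
    applies. *)
Lemma efficacy_lower T (n : R) : n <= T%:R ->
  ((T%:R - n)%:E * law alg Ja T [set h : history D T | total_play h <= n]%R <=
   expected_regret alg Ja (const_mx 1%R : 'cV[R]_1) T)%E.
Proof.
move=> nT; set B := [set h : history D T | _]; have mB : measurable B := measurable_total_play_le n.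
rewrite /expected_regret le_max; apply/orP; left; rewrite unlock.
have effE (h : history D T) : @efficacy_regret R Ja T (const_mx 1 : 'cV[R]_1) h =
    \sum_(t < T) Num.max (1 - pt (tnth h t).1) 0.
  by apply: eq_bigr => t _; rewrite /pos_part dotv1 !mxE mul1r.
under [leRHS]eq_integral do rewrite effE.
rewrite -[B]setIT -integral_indic// -ge0_integralZl//; last 2 first.
- by apply/measurable_EFinP; exact: measurable_indic.
- by rewrite lee_fin subr_ge0.
apply: ge0_le_integral => //.
- by move=> h _; rewrite -EFinM lee_fin !mulr_ge0// subr_ge0.
- by apply: measurable_funeM; apply/measurable_EFinP; exact: measurable_indic.
- apply/measurable_EFinP; apply: measurable_sum => t; apply: measurable_maxr => //.
  apply: measurable_funB => //; apply: (measurableT_comp measurable_pt).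
  exact: (measurableT_comp measurable_fst (measurable_tnth t)).
move=> h _; rewrite -EFinM lee_fin indicE.
have E0 : 0 <= \sum_(t < T) Num.max (1 - pt (tnth h t).1) 0.
  by apply: sumr_ge0 => t _; rewrite le_max lexx orbT.
have [hB|hB] := boolP (h \in B); last by rewrite mulr0.
rewrite mulr1; apply: (@le_trans _ _ (T%:R - total_play h)).
  by rewrite lerD2l lerN2; move: hB; rewrite inE.
rewrite -{1}[T]card_ord -sumr_const -sumrB; apply: ler_sum => t _.
rewrite le_max /clip01; case: (leP (pt _) 1) => [_|x1]; apply/orP.
  by left; rewrite lerD2l lerN2 le_max lexx orbT.
by right; rewrite subr_le0 le_max lexx orbT.
Qed.

End coin_regret.

(** * Asymptotics in [T] and the lower bound *)

Lemma limn_einf_ge_near {R : realType} (u : (\bar R)^nat) (l : \bar R) :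
  (\forall n \near \oo, (l <= u n)%E) -> (l <= limn_einf u)%E.
Proof.
move=> [N _ Nu]; rewrite limn_einf_lim; apply: lime_ge; first exact: is_cvg_einfs.
exists N => // m /= Nm; apply: le_ereal_inf_tmp => _ [k /= mk <-].
by apply: Nu => /=; exact: leq_trans mk.
Qed.

(** Everything is a power of [y], which is [T] to the power [- c / 4]: the choice of [n] makes
    [expR (16 a^2 n)] equal to [y^-2], and [T^(1-c)] is [T y^4]. With [u = y^3] both error terms are
    then of order [y]. *)
Lemma exploration_numeric {R : realType} (c a C T : R) (P Q E : \bar R) :
  0 < c -> 0 < a -> 0 <= C -> 1 < T ->
  let n := c * ln T / (32 * a ^+ 2) in
  let y := expR (- (c / 4 * ln T)) in
  n <= T / 2 -> y * (1 / 2 + C) <= 1 / 2 ->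
  P \is a fin_num -> Q \is a fin_num -> (0 <= Q)%E ->
  ((T - n)%:E * Q <= (C * T `^ (1 - c))%:E)%E ->
  (1 <= P + ((y ^+ 3 / 2 * expR (16 * a ^+ 2 * n))%:E +
             ((2 * y ^+ 3)^-1)%:E * Q))%E ->
  ((a * n)%:E * P <= E)%E ->
  ((c / 108 * a^-1 * ln T)%:E <= E)%E.
Proof.
move=> c0 a0 C0 T1 n y nT yC.
case: P => // p; case: Q => // q _ _; rewrite -!EFinM -!EFinD !lee_fin.
move=> q0 Tq h1 /(le_trans _); apply; rewrite lee_fin.
have T0 : 0 < T by apply: lt_trans T1.
have L0 : 0 < ln T by rewrite ln_gt0.
have y0 : 0 < y by exact: expR_gt0.
have a20 : 0 < 32 * a ^+ 2 by rewrite mulr_gt0// exprn_gt0.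
have En : expR (16 * a ^+ 2 * n) = (y ^+ 2)^-1.
  rewrite /y -expRM_natl -expRN /n; congr expR.
  by field; rewrite gt_eqF.
have ET : T `^ (1 - c) = T * y ^+ 4.
  rewrite powRD; last by rewrite (gt_eqF T0) implybT.
  rewrite powRr1 ?ltW// /powR (gt_eqF T0) /y -expRM_natl.
  by congr (_ * expR _); field.
have q4 : q <= 2 * C * y ^+ 4.
  have : T / 2 * q <= C * (T * y ^+ 4).
    rewrite -ET; apply: le_trans Tq; rewrite ler_wpM2r//; lra.
  have -> : C * (T * y ^+ 4) = T / 2 * (2 * C * y ^+ 4) by field.
  by rewrite ler_pM2l// divr_gt0.
have h2 : y ^+ 3 / 2 * (y ^+ 2)^-1 = y / 2 by field; rewrite gt_eqF.
have h3 : (2 * y ^+ 3)^-1 * q <= C * y.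
  rewrite mulrC ler_pdivrMr ?mulr_gt0 ?exprn_gt0//.
  by rewrite (_ : C * y * _ = 2 * C * y ^+ 4)//; ring.
rewrite En h2 in h1.
(* The exploration bound now reads [1 <= p + y / 2 + C y]. *)
have ph : 1 / 2 <= p by lra.
have -> : a * n * p = c / 32 * a^-1 * ln T * p by rewrite /n; field; rewrite gt_eqF.
have cL : 0 < c * a^-1 * ln T by rewrite !mulr_gt0 ?invr_gt0.
rewrite (_ : c / 108 * _ * _ = c * a^-1 * ln T * (1 / 108)); last by field; rewrite gt_eqF.
rewrite (_ : c / 32 * _ * _ * _ = c * a^-1 * ln T * (p / 32)); last by field; rewrite gt_eqF.
(* [p / 32] is at least [1 / 64], which exceeds [1 / 108]. *)
by rewrite ler_pM2l//; lra.
Qed.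

Theorem theorem7p4 (R : realType) (c Gamma : R)
  (c_gt0 : 0 < c) (c_lt1 : c < 1)
  (Gamma_gt0 : 0 < Gamma) (Gamma_le : Gamma <= 1 / 16)
  (alg : slb_method R) (alg_X : plays_in_X alg) (alg_c : consistent c alg) :
  exists (J : slb R) (xopt : 'cV[R]_(ndim J)),
    [/\ valid_slb J, is_optimum J xopt,
        (Gamma%:E <= gap J xopt)%E &
        ((c / 108 * Gamma^-1)%:E <=
           limn_einf (fun T : nat =>
             expected_regret alg J xopt T * ((ln T%:R)^-1)%:E))%E].
Proof.
have Gb : 0 <= Gamma <= 1 / 16 by rewrite (ltW Gamma_gt0).
have zb : 0 <= (0 : R) <= 1 / 16 by apply/andP; split; lra.
(* Consistency is invoked in the instance [a = 0], whose optimum is the arm [1]. *)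
have [C HC] := alg_c _ _ (coin_valid zb) (coin_optimum1 zb erefl).
exists (coin_slb Gb), (0 : 'cV[R]_1); split.
- exact: coin_valid.
- exact: coin_optimum0.
- exact: coin_gap.
apply: limn_einf_ge_near; near=> T.
(* The constant from consistency comes without a sign. *)
pose C' := Num.max C 0.
have C'0 : 0 <= C' by rewrite le_max lexx orbT.
have T1 : 1 < T%:R :> R by near: T; exact: nbhs_infty_gtr.
have T0 : 0 < T%:R :> R by exact: lt_trans T1.
have L0 : 0 < ln (T%:R : R) by rewrite ln_gt0.
set n := c * ln T%:R / (32 * Gamma ^+ 2).
have n0 : 0 <= n by rewrite divr_ge0 ?mulr_ge0 ?sqr_ge0// ltW.
(* From [ln T <= 2 s] with [s] the square root of [T], together with [c / (8 Gamma^2) <= s] for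
   large [T]. *)
have nT : n <= T%:R / 2.
  set s : R := Num.sqrt T%:R.
  have s0 : 0 < s by rewrite sqrtr_gt0.
  have sT : s ^+ 2 = T%:R by rewrite sqr_sqrtr// ltW.
  have Ls : ln (T%:R : R) <= 2 * s.
    by rewrite -sT lnXn// -[ln s *+ 2]mulr_natl ler_pM2l// ltW// ln_sublinear.
  have sM : c / (8 * Gamma ^+ 2) <= s.
    have M0 : 0 <= c / (8 * Gamma ^+ 2) by rewrite divr_ge0 ?mulr_ge0 ?sqr_ge0// ltW.
    rewrite -(ger0_norm M0) -sqrtr_sqr ler_wsqrtr//.
    by near: T; exact: nbhs_infty_ger.
  have -> : T%:R / 2 = s * (s / 2) :> R by rewrite -sT; field.
  apply: (@le_trans _ _ (c / (8 * Gamma ^+ 2) * (s / 2))); last first.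
    by rewrite ler_wpM2r// divr_ge0// ltW.
  rewrite (_ : c / _ * _ = c * (2 * s) / (32 * Gamma ^+ 2)); last first.
    by field; rewrite gt_eqF.
  have G2 : 0 < 32 * Gamma ^+ 2 by rewrite mulr_gt0// exprn_gt0.
  by rewrite /n ler_pM2r ?invr_gt0// ler_pM2l.
(* Equivalently [1 + 2 C' <= expR (c / 4 * ln T)], which follows from [1 + z <= expR z] once
   [ln T >= 8 C' / c]. *)
have yC : expR (- (c / 4 * ln (T%:R : R))) * (1 / 2 + C') <= 1 / 2.
  rewrite expRN mulrC ler_pdivrMr ?expR_gt0//.
  have LM : 8 * C' / c <= ln (T%:R : R).
    rewrite -[leLHS]expRK ler_ln ?posrE ?expR_gt0//.
    by near: T; exact: nbhs_infty_ger.
  have : 2 * C' <= c / 4 * ln T%:R.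
    move: LM; rewrite ler_pdivrMr// => LM; lra.
  have := expR_ge1Dx (c / 4 * ln (T%:R : R)); lra.
rewrite lee_pdivlMr//.
apply: (exploration_numeric c_gt0 Gamma_gt0 C'0 T1 nT yC _ _ _ _
  (exploration_bound Gb zb alg_X T n _) (safety_lower alg Gb 0 T n0)).
- by apply: fin_num_measure; exact: measurable_total_play_gt.
- by apply: fin_num_measure; exact: measurable_total_play_le.
- exact: measure_ge0.
- apply: (@le_trans _ _ (C * T%:R `^ (1 - c))%:E); last first.
    by rewrite lee_fin ler_wpM2r ?powR_ge0// le_max lexx.
  apply: le_trans (efficacy_lower alg zb _) _; first by apply: le_trans nT _; lra.
  by near: T.
- by rewrite exprn_gt0 ?expR_gt0.
Unshelve. all: by end_near. Qed.
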